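(* Every boundedly complete sub-poset $\Sigma$ of $\omega^\omega$ is a Tukey quotient of $\omega^\omega$, i.e. $\Sigma\leq_T\omega^\omega$.
   Context: $\omega^\omega$ is the set of all functions $\omega\to\omega$ with the pointwise order: $f\leq g$ iff $f(n)\leq g(n)$ for all $n\in\omega$. A subset of a poset is bounded if it has an upper bound in that poset. A subset $\Sigma\subseteq\omega^\omega$, with the induced order, is boundedly complete if every subset of $\Sigma$ that is bounded in $\omega^\omega$ has an upper bound belonging to $\Sigma$. A subset $C$ of a poset $P$ is cofinal if for every $p\in P$ there is $q\in C$ with $p\leq q$. For directed sets $P,Q$, $Q$ is a Tukey quotient of $P$, written $Q\leq_T P$, if there is a map $\phi:P\to Q$ carrying cofinal subsets of $P$ to cofinal subsets of $Q$. *)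

(* Defs.v *)
From HB Require Import structures.
From mathcomp Require Import all_boot all_order.
From mathcomp Require Import boolp classical_sets.

Set Implicit Arguments.
Unset Strict Implicit.
Unset Printing Implicit Defensive.

Local Open Scope classical_set_scope.
Local Open Scope order_scope.

(* [set_type S] unfolds to such a [sig], and so gets the order induced from the
   ambient poset. *)
HB.instance Definition _ (d : Order.disp_t) (T : porderType d) (P : pred T) :=
  [SubChoice_isSubPOrder of {x : T | P x} by <: with d].

Definition directed (d : Order.disp_t) (P : porderType d) : Prop :=
  inhabited P /\ forall x y : P, exists z : P, x <= z /\ y <= z.

Definition cofinal (d : Order.disp_t) (P : porderType d) (C : set P) : Prop :=
  forall p : P, exists2 q : P, C q & p <= q.

(* [Q] is a Tukey quotient of [P]. The relation only makes sense between
   directed sets, so directedness of both posets is part of it. *)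
Definition tukey_quotient (d d' : Order.disp_t) (Q : porderType d)
    (P : porderType d') : Prop :=
  [/\ directed Q, directed P &
      exists phi : P -> Q,
        forall C : set P, cofinal C -> cofinal (phi @` C)].

(* [A] may be empty, so a boundedly complete set is nonempty. *)
Definition boundedly_complete (d : Order.disp_t) (T : porderType d)
    (S : set T) : Prop :=
  forall A : set T, A `<=` S -> has_ubound A -> exists2 s : T, S s & ubound A s.

(* As a porderType, [baire] carries the pointwise order of [boolp]. *)
Notation baire := (nat -> nat).

(* Main.v *)
Require Import Defs.
From mathcomp Require Import all_boot all_order.
From mathcomp Require Import boolp classical_sets.

(** Bounded completeness says exactly that the inclusion of [Sigma] into the
    Baire space maps unbounded sets to unbounded sets. Dually, sending [f] to an
    upper bound in [Sigma] of all members of [Sigma] below [f] preserves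
    cofinality: if [f] dominates [p], then so does its image. *)

Local Open Scope classical_set_scope.
Local Open Scope order_scope.

Lemma baire_directed : directed baire.
Proof.
split=> [|f g]; first by constructor; exact: (fun=> 0%N).
exists (fun n => maxn (f n) (g n)).
by split; apply/lefP => n; rewrite leEnat ?leq_maxl ?leq_maxr.
Qed.

Section BoundedlyComplete.
Context {d : Order.disp_t} {T : porderType d} {S : set T}.
Hypothesis bcS : boundedly_complete S.

(** The members of [S] below [f] form a subset of [S] bounded by [f] itself, so bounded completeness
    applies. *)
Lemma boundedly_complete_dominating (f : T) :
  exists s : set_type S, forall p : set_type S, \val p <= f -> p <= s.
Proof.
have [|| s Ss ub_s] := bcS (S `&` [set t | t <= f]).
- exact: subIsetl.
- by exists f => t [].
exists (SigSub (mem_set Ss)) => p le_pf.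
by rewrite -Order.le_val; apply: ub_s; split; first exact: (set_valP p).
Qed.

Lemma boundedly_complete_directed : directed T -> directed (set_type S).
Proof.
case=> [[t0] dirT]; split.
  (* Even if no member of [S] lies below [t0], the empty set has an upper bound in [S]. *)
  by have [s _] := boundedly_complete_dominating t0; constructor.
move=> x y; have [t [le_xt le_yt]] := dirT (\val x) (\val y).
(* The bound [t] may lie outside [S]; it is traded for [s] in [S], which is above [x] and [y] since
   both lie below [t]. *)
have [s dom_s] := boundedly_complete_dominating t.
by exists s; split; apply: dom_s.
Qed.

Lemma boundedly_complete_tukey_quotient :
  directed T -> tukey_quotient (set_type S) T.
Proof.
move=> dirT; split=> //; first exact: boundedly_complete_directed.
have [phi dom_phi] := choice boundedly_complete_dominating.
exists phi => C cofC p; have [f Cf le_pf] := cofC (\val p).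
by exists (phi f); [exists f | apply: dom_phi].
Qed.

End BoundedlyComplete.

Theorem theorem3p3 (Sigma : set baire) :
  boundedly_complete Sigma -> tukey_quotient (set_type Sigma) baire.
Proof.
by move=> bc; apply: boundedly_complete_tukey_quotient bc baire_directed.
Qed.
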